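(* The function $L:\Omega_{240}\to[8]\times[5]\times[3]\times[2]$ defined by $L(cx_0)=\kappa'(c)$ for $c\in C$ is a bijection whose inverse is a morphism of partially ordered sets from $[8]\times[5]\times[3]\times[2]$ with the product order on chains to $\Omega_{240}$ with the Bruhat order on packings.
   Context: Write $\mathbf{8}=\{1,\dots,8\}$. An $\mathbf{8}$-labelled Fano plane is a set of seven $3$-element subsets (''triples'') of $\mathbf{8}$ that are the lines of a Fano plane $PG(2,2)$ on seven of the eight labels. There are $240$ of these, and they index (and are identified with) the $240$ packings of $PG(3,2)$ (partitions of the $35$ lines into seven spreads, a spread being a partition of the $15$ points into five lines). Their set is denoted $\Omega_{240}$. The symmetric group $S_8$ acts transitively on $\Omega_{240}$ by permuting labels: $wx=\{w(A):A\in x\}$; permutations are composed right to left. Let $x_0=\{127,136,145,235,246,347,567\}$, where $ijk$ denotes $\{i,j,k\}$. $\ell$ denotes the length function of $S_8$ with respect to the simple transpositions $s_i=(i,i+1)$, so that $\ell(w)$ is the number of inversions of $w$. For $w\in S_8$ and $2\le j\le 8$ let $\kappa_j(w)=|\{i: 1\le i<j,\ w(i)>w(j)\}|$. Let $C=\{w\in S_8:\kappa_7(w)=\kappa_6(w)=\kappa_4(w)=0\}$ (a set of $240$ permutations), and for $w\in C$ let $\kappa'(w)=(\kappa_8(w),\kappa_5(w),\kappa_3(w),\kappa_2(w))$. Each packing is of the form $cx_0$ for a unique $c\in C$. For $x\in\Omega_{240}$ the height is $\mathrm{ht}(x)=\min\{\ell(w): w\in S_8,\ wx_0=x\}$. For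 a transposition $t\in S_8$ and a packing $x$, write $x\prec tx$ if $\mathrm{ht}(x)<\mathrm{ht}(tx)$. The Bruhat order $(\Omega_{240},\le)$ on packings is the reflexive, transitive closure of $\prec$. For $d>0$, $[d]$ is the chain $\{0,1,\dots,d-1\}$ with its usual order; in a product of chains, $(a_i)\le(b_i)$ if and only if $a_i\le b_i$ for all $i$. A morphism of posets is an order-preserving function. *)

(* Defs.v *)
From HB Require Import structures.
From mathcomp Require Import all_boot all_order all_fingroup all_algebra.

Set Implicit Arguments.
Unset Strict Implicit.
Unset Printing Implicit Defensive.

Import Order.TTheory GRing.Theory.

(* The labels 1, ..., 8 are the elements of 'I_8, label k being the ordinal   *)
(* of value k - 1; the reduction modulo 8 only serves to make lab total.      *)
Definition lab (k : nat) : 'I_8 := Ordinal (ltn_pmod k.-1 (isT : 0 < 8)).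

Definition triple (i j k : nat) : {set 'I_8} := [set lab i; lab j; lab k].

(* The points of PG(2,2) are the 1-dimensional subspaces of F_2^3, each of    *)
(* which is given by its only nonzero vector; the lines are the sets of       *)
(* nonzero vectors of the 2-dimensional subspaces (here, row spaces).         *)
Definition pg22_points : {set 'rV['F_2]_3} := [set v | v != 0%R].

Definition pg22_lines : {set {set 'rV['F_2]_3}} :=
  [set [set v in pg22_points | (v <= A)%MS] | A : 'M['F_2]_3 & \rank A == 2].

Definition fano_plane (x : {set {set 'I_8}}) : bool :=
  [exists f : {ffun 'rV['F_2]_3 -> 'I_8},
    dinjectiveb f [in pg22_points] && (x == [set f @: (l : {set _}) | l in pg22_lines])].

Definition Omega240 := {x : {set {set 'I_8}} | fano_plane x}.

HB.instance Definition _ := Finite.on Omega240.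
HB.instance Definition _ := SubType.on Omega240.

Definition relabel_set (w : 'S_8) (x : {set {set 'I_8}}) : {set {set 'I_8}} :=
  [set w @: (A : {set 'I_8}) | A in x].

Lemma relabel_set_fano w x : fano_plane x -> fano_plane (relabel_set w x).
Proof.
case/existsP=> f /andP[/dinjectiveP inj_f /eqP->]; apply/existsP.
exists [ffun v => w (f v)]; apply/andP; split.
  by apply/dinjectiveP=> u v Pu Pv; rewrite !ffunE => /perm_inj/inj_f->.
apply/eqP; rewrite /relabel_set -imset_comp; apply: eq_imset => l /=.
by rewrite -imset_comp; apply: eq_imset => v /=; rewrite ffunE.
Qed.

Definition relabel (w : 'S_8) (x : Omega240) : Omega240 :=
  Sub (relabel_set w (val x)) (relabel_set_fano w (valP x)).

Definition x0_set : {set {set 'I_8}} :=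
  [set triple 1 2 7; triple 1 3 6; triple 1 4 5; triple 2 3 5;
       triple 2 4 6; triple 3 4 7; triple 5 6 7].

Definition x0_seq : seq (seq 'I_8) :=
  [seq [seq lab k | k <- t] |
   t <- [:: [:: 1; 2; 7]; [:: 1; 3; 6]; [:: 1; 4; 5]; [:: 2; 3; 5];
            [:: 2; 4; 6]; [:: 3; 4; 7]; [:: 5; 6; 7]]].

Lemma x0_setP (B : {set 'I_8}) :
  reflect (exists2 t, t \in x0_seq & B = [set k in t]) (B \in x0_set).
Proof.
have tripleE i j k : triple i j k = [set x in [:: lab i; lab j; lab k]].
  by apply/setP=> x; rewrite !inE -orbA.
have -> : (B \in x0_set) = has (fun t => B == [set k in t]) x0_seq.
  by rewrite /x0_set !inE !tripleE /= orbF -!orbA.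
by apply: (iffP hasP) => -[t tx /eqP]; exists t => //; apply/eqP.
Qed.

(* An identification of x0 with PG(2,2), taking the standard basis of F_2^3   *)
(* to the labels 1, 2 and 3.                                                  *)
Definition f0 (a b c : 'F_2) : 'I_8 :=
  lab (nth 0 [:: 0; 1; 2; 7; 3; 6; 5; 4] (a + 2 * b + 4 * c)).

Definition row3 (a b c : 'F_2) : 'rV['F_2]_3 := \row_j nth 0%R [:: a; b; c] j.

Lemma row3P (v : 'rV['F_2]_3) : exists a b c, v = row3 a b c.
Proof.
exists (v 0 0)%R, (v 0 1)%R, (v 0 (inord 2))%R; apply/rowP=> j; rewrite mxE.
by case: j => [[|[|[|//]]] lt_j] /=; congr (v _ _);
  apply: val_inj; rewrite //= inordK.
Qed.

Lemma F2P (a : 'F_2) : a = 0%R \/ a = 1%R.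
Proof. by case: a => [[|[|//]]] lt_a; [left | right]; apply: val_inj. Qed.

Lemma row3D a b c a' b' c' :
  (row3 a b c + row3 a' b' c' = row3 (a + a') (b + b') (c + c'))%R.
Proof. by apply/rowP=> -[[|[|[|//]]] ?]; rewrite !mxE. Qed.

Lemma row3_inj a b c a' b' c' :
  row3 a b c = row3 a' b' c' -> [/\ a = a', b = b' & c = c'].
Proof.
by move/rowP=> e; split;
  [have := e 0%R | have := e 1%R | have := e (inord 2)]; rewrite !mxE //= !inordK.
Qed.

Lemma row3_0 : (row3 0 0 0 = 0)%R.
Proof. by apply/rowP=> -[[|[|[|//]]] ?]; rewrite !mxE. Qed.

Lemma pg22_linesP (l : {set 'rV['F_2]_3}) :
  reflect (exists u v, [/\ u != 0, v != 0, u != v & l = [set u; v; u + v]])%R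
          (l \in pg22_lines).
Proof.
have addvv (w : 'rV['F_2]_3) : (w + w = 0)%R.
  by apply/rowP=> j; rewrite !mxE; move: (w _ j) => a; case: (F2P a) => ->; apply/eqP.
have F2s (w : 'rV['F_2]_3) (a : 'F_2) :
   (a *: w)%R = if a == 0%R then 0%R else w.
  by case: (F2P a) => -> /=; rewrite ?scale0r ?scale1r.
have spanE (u v : 'rV['F_2]_3) (D : 'rV['F_2]_(1 + 1)) :
   (D *m col_mx u v = D 0 0 *: u + D 0 1 *: v)%R.
  rewrite -[in LHS](@hsubmxK _ _ 1 1 D) mul_row_col.
  rewrite [lsubmx D]mx11_scalar [rsubmx D]mx11_scalar !mul_scalar_mx !mxE.
  by congr (D _ _ *: _ + D _ _ *: _)%R; apply: val_inj.
have lineE (u v : 'rV['F_2]_3) : (u != 0 -> v != 0 -> u != v ->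
   [set w in pg22_points | (w <= col_mx u v)%MS] = [set u; v; u + v])%R.
  move=> u0 v0 uv; apply/setP=> w; rewrite !inE; apply/andP/idP.
    case=> w0 /submxP[D def_w]; move: w0; rewrite {}def_w spanE !F2s.
    by do 2?case: ifP; rewrite ?addr0 ?add0r ?eqxx ?orbT.
  have uB : (u <= col_mx u v)%MS by rewrite -addsmxE addsmxSl.
  have vB : (v <= col_mx u v)%MS by rewrite -addsmxE addsmxSr.
  case/orP=> [/orP[]|] /eqP-> //; rewrite addmx_sub //; split=> //.
  by apply: contraNneq uv => uv0; rewrite -[u]addr0 -(addvv v) addrA uv0 add0r.
have freeE (u v : 'rV['F_2]_3) : (u != 0 -> v != 0 -> u != v ->
    row_free (col_mx u v))%R.
  move=> u0 v0 uv; rewrite -kermx_eq0; apply/rowV0P=> D /sub_kermxP.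
  rewrite spanE !F2s => D0; apply/rowP=> j.
  have [D00 D01] : D 0%R 0%R = 0%R /\ D 0%R 1%R = 0%R.
    move: D0; do 2?case: eqP => //; rewrite ?addr0 ?add0r => _ _ /eqP.
    - by rewrite (negPf v0).
    - by rewrite (negPf u0).
    - by move=> uv0; case/eqP: uv; rewrite -[u]addr0 -(addvv v) addrA (eqP uv0) add0r.
  rewrite mxE; case: j => -[|[|//]] lt_j.
    by rewrite -[RHS]D00; congr (D _ _); apply: val_inj.
  by rewrite -[RHS]D01; congr (D _ _); apply: val_inj.
apply: (iffP imsetP) => [[A] | [u [v [u0 v0 uv ->]]]].
  rewrite inE => /eqP rA ->.
  have [B freeB eqB] : exists2 B : 'M['F_2]_(1 + 1, 3),
      row_free B & forall w : 'rV_3, (w <= B)%MS = (w <= A)%MS.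
    move: (row_base A) (row_base_free A) (eq_row_base A); rewrite rA => B fB eB.
    by exists B => // w; rewrite eB.
  pose u := usubmx B; pose v := dsubmx B.
  have defB : B = col_mx u v by rewrite vsubmxK.
  have nz (D : 'rV_2) : D != 0%R -> (D *m B != 0)%R.
    by apply: contraNneq => DB; rewrite (row_free_inj freeB (etrans DB (esym (mul0mx _ _)))).
  have D0 (a b : 'F_2) : ((a, b) != (0, 0) ->
      (\row_(j < 2) if j == 0 then a else b) != 0)%R.
    apply: contraNneq => /rowP e; have := e 0%R; have := e 1%R.
    by rewrite !mxE /= => -> ->.
  have nzuv (a b : 'F_2) : ((a, b) != (0, 0) -> a *: u + b *: v != 0)%R.
    by move/D0/nz; rewrite defB spanE !mxE.
  have u0 : u != 0%R by have := nzuv 1%R 0%R isT; rewrite scale1r scale0r addr0.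
  have v0 : v != 0%R by have := nzuv 0%R 1%R isT; rewrite scale1r scale0r add0r.
  have uv : u != v.
    have := nzuv 1%R 1%R isT; rewrite !scale1r.
    by apply: contraNneq => ->; rewrite addvv.
  exists u, v; split=> //; rewrite -lineE // -defB.
  by apply/setP=> w; rewrite !inE eqB.
exists <<col_mx u v>>%MS; first by rewrite inE mxrank_gen; apply: freeE.
by rewrite -lineE //; apply/setP=> w; rewrite !inE genmxE.
Qed.

Lemma x0_fano : fano_plane x0_set.
Proof.
pose f := [ffun v : 'rV['F_2]_3 => f0 (v 0 0)%R (v 0 1)%R (v 0 (inord 2))%R].
have fE a b c : f (row3 a b c) = f0 a b c.
  by rewrite ffunE !mxE /= inordK.
have fline u v : f @: [set u; v; (u + v)%R] = [set x in [:: f u; f v; f (u + v)%R]].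
  by rewrite !imsetU !imset_set1; apply/setP=> x; rewrite !inE -orbA.
apply/existsP; exists f; apply/andP; split.
  apply/dinjectiveP=> u v; rewrite !inE.
  have [a [b [c ->]]] := row3P u; have [a' [b' [c' ->]]] := row3P v.
  rewrite !fE -row3_0.
  case: (F2P a) => ->; case: (F2P b) => ->; case: (F2P c) => ->;
  case: (F2P a') => ->; case: (F2P b') => ->; case: (F2P c') => ->;
  by rewrite ?eqxx // => _ _ /(congr1 val).
apply/eqP/setP=> B; apply/x0_setP/imsetP.
  pose w (k : 'I_8) := nth 0%R [:: row3 1 0 0; row3 0 1 0; row3 0 0 1;
    row3 1 1 1; row3 0 1 1; row3 1 0 1; row3 1 1 0]%R k.
  have w1 : w (lab 1) = (row3 1 0 0)%R by [].
  have w2 : w (lab 2) = (row3 0 1 0)%R by [].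
  have w3 : w (lab 3) = (row3 0 0 1)%R by [].
  have w4 : w (lab 4) = (row3 1 1 1)%R by [].
  have w6 : w (lab 6) = (row3 1 0 1)%R by [].
  have w5 : w (lab 5) = (row3 0 1 1)%R by [].
  case=> t tx ->; set u := w (nth ord0 t 0); set v := w (nth ord0 t 1).
  have [u0 v0 uv tE] : [/\ u != 0, v != 0, u != v &
      [:: f u; f v; f (u + v)] = t]%R.
    rewrite /u /v -row3_0; move: tx.
    rewrite !in_cons in_nil orbF; repeat case/orP; move/eqP->.
    1-7: rewrite /= ?w1 ?w2 ?w3 ?w4 ?w5 ?w6 row3D !fE; split;
      first [by apply/eqP=> /row3_inj[] | by congr [:: _; _; _]; apply: val_inj].
  exists [set u; v; (u + v)%R]; first by apply/pg22_linesP; exists u, v.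
  by rewrite fline tE.
case=> l /pg22_linesP[u [v [u0 v0 uv ->]]] ->.
rewrite fline.
suff /hasP[t tx e] : has (perm_eq [:: f u; f v; f (u + v)%R]) x0_seq.
  by exists t => //; apply/setP=> x; rewrite !inE -(perm_mem e) !inE.
move: u0 v0 uv.
have [a [b [c ->]]] := row3P u; have [a' [b' [c' ->]]] := row3P v.
rewrite row3D !fE -row3_0.
case: (F2P a) => ->; case: (F2P b) => ->; case: (F2P c) => ->;
case: (F2P a') => ->; case: (F2P b') => ->; case: (F2P c') => ->;
by rewrite ?eqxx // => _ _ _; vm_compute.
Qed.

Definition x0 : Omega240 := Sub x0_set x0_fano.

Lemma perm_extend (s t : seq 'I_8) :
  uniq s -> uniq t -> size s = size t -> exists w : 'S_8, map w s = t.
Proof.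
elim: s t => [|a s IHs] [|b t] //=; first by exists 1%g.
case/andP=> sa us /andP[tb ut] [/(IHs t us ut)[w def_t]].
have twa : w a \notin t by rewrite -def_t mem_map //; apply: perm_inj.
exists (w * tperm (w a) b)%g; rewrite permM tpermL -[t in RHS]def_t; congr cons.
apply/eq_in_map => c sc; have tc : w c \in t by rewrite -def_t map_f.
by rewrite permM tpermD //; [apply: contraNneq twa | apply: contraNneq tb] => ->.
Qed.

Lemma relabel_x0_trans (x : Omega240) : exists w, relabel w x0 == x.
Proof.
case/existsP: x0_fano => f /andP[/dinjectiveP inj_f /eqP def_x0].
case/existsP: (valP x) => g /andP[/dinjectiveP inj_g /eqP def_x].
pose e := enum pg22_points.
have inj_e (h : {ffun 'rV['F_2]_3 -> 'I_8}) :
    {in [in pg22_points] &, injective h} -> uniq (map h e).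
  move=> inj_h; rewrite map_inj_in_uniq ?enum_uniq // => u v.
  by rewrite !mem_enum; apply: inj_h.
have [|w wP] := perm_extend (inj_e f inj_f) (inj_e g inj_g).
  by rewrite !size_map.
have {}wP v : v \in pg22_points -> w (f v) = g v.
  rewrite -mem_enum -/e => ev; move: wP; rewrite -map_comp => /eq_in_map wP.
  exact: wP.
exists w; rewrite -val_eqE /= /relabel_set def_x0 def_x; apply/eqP.
rewrite -imset_comp; apply: eq_in_imset => l /=.
case/imsetP=> A _ ->; rewrite -imset_comp.
by apply: eq_in_imset => v /=; rewrite inE => /andP[Pv _]; apply: wP.
Qed.

(* s_i with i ranging over 0, ..., 6; a word is multiplied from left to right *)
(* here, but reversing all words does not change the length.                  *)
Definition simple_tperm (i : 'I_7) : 'S_8 :=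
  tperm (widen_ord (leqnSn 7) i) (lift ord0 i).

Definition is_word (w : 'S_8) (s : seq 'I_7) : bool :=
  (\prod_(i <- s) simple_tperm i)%g == w.

Lemma simple_tperm_gen (w : 'S_8) :
  exists n, [exists s : n.-tuple 'I_7, is_word w s].
Proof.
suff [s ws] : exists s, is_word w s.
  by exists (size s); apply/existsP; exists (in_tuple s).
have prodW u v : (exists s, is_word u s) -> (exists s, is_word v s) ->
    exists s, is_word (u * v)%g s.
  case=> s /eqP us [t /eqP vt]; exists (s ++ t).
  by rewrite /is_word big_cat /= us vt.
have oneW : exists s, is_word 1%g s by exists [::]; rewrite /is_word big_nil.
have tpermW d : forall i j : 'I_8, j = i + d :> nat -> exists s, is_word (tperm i j) s.
  elim: d => [|d IHd] i j def_j.
    by rewrite (_ : j = i) ?tperm1 //; apply: val_inj; rewrite /= def_j addn0.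
  have ltk : i + d < 7 by rewrite -ltnS -addnS -def_j.
  pose k := widen_ord (leqnSn 7) (Ordinal ltk).
  have def_j' : j = lift ord0 (Ordinal ltk).
    by apply: val_inj; rewrite /= def_j addnS.
  have sW : exists s, is_word (tperm k j) s.
    by exists [:: Ordinal ltk]; rewrite /is_word big_seq1 def_j'.
  have [d0 | d0] := posnP d.
    rewrite (_ : i = k) //; apply: val_inj; by rewrite /= d0 addn0.
  have nik : i != k by rewrite -val_eqE /= -{1}[i : nat]addn0 eqn_add2l neq_ltn d0.
  have nij : i != j by rewrite -val_eqE /= def_j -{1}[i : nat]addn0 eqn_add2l.
  have nkj : k != j by rewrite -val_eqE /= def_j addnS neq_ltn ltnSn.
  have -> : tperm i j = (tperm k j * tperm i k * tperm k j)%g.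
    have -> : tperm i j = (tperm i k ^ tperm k j)%g.
      by rewrite tpermJ tpermL tpermD // eq_sym.
    by rewrite conjgE tpermV mulgA.
  exact: prodW (prodW _ _ sW (IHd i k erefl)) sW.
have [ts -> _] := prod_tpermP w.
elim: ts => [|[i j] ts IHts]; rewrite ?big_nil ?big_cons //=; apply: prodW IHts.
have [le_ij | /ltnW le_ji] := leqP i j.
  by apply: (tpermW (j - i)); rewrite subnKC.
by rewrite tpermC; apply: (tpermW (i - j)); rewrite subnKC.
Qed.

Definition coxeter_length (w : 'S_8) : nat := ex_minn (simple_tperm_gen w).

Lemma ht_exists (x : Omega240) :
  exists n, [exists w, (relabel w x0 == x) && (coxeter_length w == n)].
Proof.
have [w wx] := relabel_x0_trans x; exists (coxeter_length w).
by apply/existsP; exists w; rewrite wx eqxx.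
Qed.

Definition ht (x : Omega240) : nat := ex_minn (ht_exists x).

Definition bruhat_step (x y : Omega240) : bool :=
  [exists i, [exists j,
    [&& i != j, y == relabel (tperm i j) x & ht x < ht y]]].

Definition bruhat : rel Omega240 := connect bruhat_step.

Lemma bruhat_ht x y : bruhat x y -> x = y \/ ht x < ht y.
Proof.
case/connectP=> p; elim: p x => [|z p IHp] x /=; first by left.
case/andP=> /existsP[i /existsP[j /and3P[_ _ lt_xz]]] zp def_y; right.
by case: (IHp z zp def_y) => [<-//|]; apply: ltn_trans.
Qed.

Lemma bruhat_anti : antisymmetric bruhat.
Proof.
move=> x y /andP[/bruhat_ht[] // lt_xy /bruhat_ht[] // lt_yx].
by have := ltn_trans lt_xy lt_yx; rewrite ltnn.
Qed.

Fact bruhat_display : Order.disp_t. Proof. exact: Order.Disp tt tt. Qed.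

HB.instance Definition _ :=
  Order.Le_isPOrder.Build bruhat_display Omega240
    (@connect0 _ bruhat_step) bruhat_anti (@connect_trans _ bruhat_step).

Definition kappa (j : nat) (w : 'S_8) : nat :=
  #|[set i : 'I_8 | (i < lab j) && (w (lab j) < w i)]|.

Lemma kappa_lt j w : 0 < j -> j <= 8 -> kappa j w < j.
Proof.
case: j => // j _ lt_j8; rewrite ltnS /kappa.
have lab_j : lab j.+1 = j :> nat by rewrite /= modn_small.
rewrite -[leqRHS](size_iota 0) cardE -(size_map val).
apply: uniq_leq_size; first by rewrite (map_inj_uniq val_inj) enum_uniq.
move=> _ /mapP[i i_j ->]; move: i_j.
by rewrite mem_enum inE lab_j mem_iota => /andP[].
Qed.

Definition C : {set 'S_8} :=
  [set w | [&& kappa 7 w == 0, kappa 6 w == 0 & kappa 4 w == 0]].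

Definition grid := ('I_8 *p 'I_5 *p 'I_3 *p 'I_2)%type.

Definition kappa' (w : 'S_8) : grid :=
  (Ordinal (kappa_lt w (isT : 0 < 8) isT), Ordinal (kappa_lt w (isT : 0 < 5) isT),
   Ordinal (kappa_lt w (isT : 0 < 3) isT), Ordinal (kappa_lt w (isT : 0 < 2) isT)).

(* Main.v *)
Require Import Defs.
From HB Require Import structures.
From mathcomp Require Import all_boot all_order all_fingroup all_algebra.

(** Write a permutation as a word in the simple transpositions. For a code
    (i, j, k, l) in the grid let [word] be the concatenation of the first l
    letters of s_1, the first k of s_2 s_1, the first j of s_4 s_3 s_2 s_1 and
    the first i of s_7 s_6 ... s_1, the leftmost letter acting first. Each of
    the four blocks is a cycle that lowers one value and shifts the values
    above it up by one, so the permutation spelled by the word is the element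
    of C with Lehmer code (i, j, k, l) ([kappa'_rep]). It is the only one,
    because a permutation is determined by its kappa statistics ([kappa_inj]).

    Let M(a) be the image of x0 under the permutation with code a. Two facts
    about the 240 planes M(a) are checked by evaluating them. They are pairwise
    distinct ([lines_pairwise]), and a simple transposition sends each M(a) to
    some M(b) whose word is at most one letter longer ([lines_closed]). By
    induction on words, the plane reached from x0 by a word of length n is M(b)
    for some b whose word has length at most n ([plane_reach]). Therefore M is
    onto, hence a bijection, and the height of M(a) is exactly the length of
    the word of a ([word_reduced]).

    For monotonicity, raising one coordinate of the code inserts one letter in
    the word. If the word is u i v, then the permutation it spells is that of
    u v followed by the conjugate of s_i by the permutation of v, which is a
    transposition. Thus the two planes differ by a transposition
    ([plane_insert]), and as the height goes up by one, this is a step of the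
    Bruhat order ([bruhat_insert]). A comparison in the product order is a chain
    of such insertions ([bruhat_word]), so M is a morphism, and L is its
    inverse. *)

Set Implicit Arguments.
Unset Strict Implicit.
Unset Printing Implicit Defensive.

(** * Words acting on planes *)

Definition word_perm (s : seq 'I_7) : 'S_8 := (\prod_(i <- s) simple_tperm i)%g.

Definition plane (s : seq 'I_7) : Omega240 := relabel (word_perm s) x0.

(** Products of transpositions are modelled on plain numbers, where they can be
    evaluated: permutations of 'I_8 are opaque to computation. *)
Definition swap (i k : nat) : nat :=
  if k == i then i.+1 else if k == i.+1 then i else k.

Definition act (s : seq nat) (k : nat) : nat := foldl (fun k i => swap i k) k s.

Lemma simple_tpermE (i : 'I_7) (k : 'I_8) : simple_tperm i k = swap i k :> nat.
Proof.
rewrite /simple_tperm /swap permE /= -!val_eqE /=.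
by case: ifP => // _; case: ifP.
Qed.

Lemma word_permE (s : seq 'I_7) (k : 'I_8) : word_perm s k = act (map val s) k :> nat.
Proof.
rewrite /word_perm; elim: s k => [|i s IHs] k; first by rewrite big_nil perm1.
by rewrite big_cons permM IHs simple_tpermE.
Qed.

Lemma relabelM u v x : relabel (u * v)%g x = relabel v (relabel u x).
Proof.
apply: val_inj; rewrite /= /relabel_set -imset_comp.
apply: eq_imset => A /=; rewrite -imset_comp.
by apply: eq_imset => k; rewrite /= permM.
Qed.

Lemma plane_rcons s i : plane (rcons s i) = relabel (simple_tperm i) (plane s).
Proof. by rewrite /plane -relabelM /word_perm -cats1 big_cat big_seq1. Qed.

(** Pulling the letter i past v turns s_i into its conjugate by v, which is
    again a transposition. *)
Lemma plane_insert u i v :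
  exists p q, p != q /\ plane (u ++ i :: v) = relabel (tperm p q) (plane (u ++ v)).
Proof.
rewrite /plane /word_perm !big_cat big_cons /=.
set U := (\prod_(j <- u) _)%g; set V := (\prod_(j <- v) _)%g.
exists (V (widen_ord (leqnSn 7) i)), (V (lift ord0 i)); split.
  by rewrite (inj_eq perm_inj) -val_eqE /= neq_ltn ltnSn.
by rewrite -relabelM -tpermJ conjgE !mulgA mulgK.
Qed.

(** * Deciding equality of planes *)

(** The lines of the relabelled plane, each as a sorted list of numbers, so that
    comparing two lines is comparing two lists. *)
Definition lines (f : nat -> nat) : seq (seq nat) :=
  [seq sort leq [seq f (val k) | k <- t] | t <- x0_seq].

Lemma mem_relabel (w : 'S_8) (B : {set 'I_8}) :
  reflect (exists2 t, t \in x0_seq & B = [set k in map w t])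
          (B \in val (relabel w x0)).
Proof.
have im (t : seq 'I_8) : w @: [set k in t] = [set k in map w t].
  apply/setP=> k; rewrite inE; apply/imsetP/mapP=> -[l tl ->]; exists l => //.
    by rewrite inE in tl.
  by rewrite inE.
apply: (iffP imsetP) => [[A /x0_setP[t tx ->] ->] | [t tx ->]].
  by exists t.
by exists [set k in t] => //; apply/x0_setP; exists t.
Qed.

Lemma eq_triple (f g : 'S_8) t u : t \in x0_seq -> u \in x0_seq ->
  ([set k in map f t] == [set k in map g u])
    = (sort leq (map val (map f t)) == sort leq (map val (map g u))).
Proof.
have uniq_x0 t' : t' \in x0_seq -> uniq t'.
  by apply/allP: t'; vm_compute.
move=> /uniq_x0 ut /uniq_x0 uu.
have sortE a b : (sort leq a == sort leq b) = perm_eq a b.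
  exact: (sameP eqP (perm_sortP leq_total leq_trans anti_leq a b)).
have permE : perm_eq (map val (map f t)) (map val (map g u))
    = perm_eq (map f t) (map g u) 
  by apply/idP/idP=> [/(perm_map_inj val_inj)|/(perm_map val)].
rewrite sortE permE; apply/eqP/idP=> [/setP e | /perm_mem e].
  apply: uniq_perm; rewrite ?(map_inj_uniq perm_inj) // => k.
  by have := e k; rewrite !inE.
by apply/setP=> k; rewrite !inE e.
Qed.

(** Two relabelled planes have equally many lines, so inclusion is already
    equality; only one inclusion has to be evaluated. *)
Lemma eq_plane s t :
  (plane s == plane t)
    = all [in lines (act (map val t))] (lines (act (map val s))).
Proof.
have linesE r : lines (act (map val r)) =
    [seq sort leq (map val (map (word_perm r) u)) | u <- x0_seq].
  apply: eq_map => u; congr sort; rewrite -map_comp.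
  by apply: eq_map => k; rewrite /= word_permE.
have card_plane r : #|val (plane r)| = #|x0_set|.
  exact/card_imset/imset_inj/perm_inj.
rewrite !linesE -val_eqE eqEcard !card_plane leqnn andbT.
apply/idP/idP=> [/subsetP sub | /allP sub].
  apply/allP=> _ /mapP[a ax ->].
  have /sub/mem_relabel[b bx /eqP] :
      [set k in map (word_perm s) a] \in val (relabel (word_perm s) x0).
    by apply/mem_relabel; exists a.
  by rewrite eq_triple // => /eqP e; apply/mapP; exists b.
apply/subsetP=> B /mem_relabel[a ax ->]; apply/mem_relabel.
have /sub/mapP[b bx /eqP e] := map_f (fun u => sort leq (map val (map (word_perm s) u))) ax.
by exists b => //; apply/eqP; rewrite eq_triple.
Qed.

(** * Heights and words *)

Lemma coxeter_length_le s : coxeter_length (word_perm s) <= size s.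
Proof.
rewrite /coxeter_length; case: ex_minnP => n _; apply.
by apply/existsP; exists (in_tuple s); rewrite /is_word eqxx.
Qed.

Lemma coxeter_length_word w :
  exists s, word_perm s = w /\ size s = coxeter_length w.
Proof.
rewrite /coxeter_length; case: ex_minnP => n /existsP[s /eqP ws] _.
by exists s; rewrite size_tuple.
Qed.

Lemma ht_plane_le s : ht (plane s) <= size s.
Proof.
apply: leq_trans (coxeter_length_le s); rewrite /ht; case: ex_minnP => n _; apply.
by apply/existsP; exists (word_perm s); rewrite !eqxx.
Qed.

(** The height is the length of a shortest word leading from x0 to x. *)
Lemma ht_word x : exists s, plane s = x /\ size s = ht x.
Proof.
rewrite /ht; case: ex_minnP => n /existsP[w /andP[/eqP wx /eqP <-]] _.
by have [s [sw szs]] := coxeter_length_word w; exists s; rewrite /plane sw.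
Qed.

(** * The words indexed by the grid *)

Definition code := (nat * nat * nat * nat)%type.

Definition codes : seq code :=
  [seq (a, l) | a <- [seq (a, k) | a <- [seq (i, j) | i <- iota 0 8, j <- iota 0 5],
                                   k <- iota 0 3], l <- iota 0 2].

(** [codes] is an explicit list for evaluation; this is the bridge from it to
    the elements of the grid. *)
Lemma mem_codes i j k l :
  ((i, j, k, l) \in codes) = [&& i < 8, j < 5, k < 3 & l < 2].
Proof.
have inI m n : (m \in iota 0 n) = (m < n) by rewrite mem_iota.
apply/idP/and4P=> [|[ri rj rk rl]]; last first.
  by repeat (apply: allpairs_f; last by rewrite inI); rewrite inI.
have /allP in_range : all (fun c : code =>
    [&& c.1.1.1 < 8, c.1.1.2 < 5, c.1.2 < 3 & c.2 < 2]) codes by vm_compute.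
by move/in_range/and4P.
Qed.

Definition nat_word (c : code) : seq nat :=
  let: (i, j, k, l) := c in
  take l (rev (iota 0 1)) ++ take k (rev (iota 0 2)) ++
  take j (rev (iota 0 4)) ++ take i (rev (iota 0 7)).

(** The letters s_n, ..., s_1, in this order. The first m of them spell the cycle
    that sends n + 1 to n + 1 - m and raises the values in between by one. *)
Definition down (n : nat) : seq 'I_7 := rev (take n (enum 'I_7)).

(** Positions 2, 3, 5 and 8 are the ones whose kappa is free on C; a block for
    position j creates inversions with position j as right end only. *)
Definition word (c : code) : seq 'I_7 :=
  let: (i, j, k, l) := c in
  take l (down 1) ++ take k (down 2) ++ take j (down 4) ++ take i (down 7).

Lemma word_nat c : map val (word c) = nat_word c.
Proof.
case: c => [[[i j] k] l].
have dn n : n <= 7 -> map val (down n) = rev (iota 0 n).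
  by move=> n7; rewrite /down map_rev map_take val_enum_ord take_iota (minn_idPl n7).
by rewrite /= !map_cat !map_take !dn.
Qed.

Lemma size_word c : size (word c) = size (nat_word c).
Proof. by rewrite -word_nat size_map. Qed.

(** * Evaluating the 240 planes *)

Lemma lines_pairwise :
  pairwise (fun l l' => ~~ all [in l'] l)
           [seq lines (act (nat_word c)) | c <- codes].
Proof. by vm_cast_no_check (erefl true). Qed.

Lemma uniq_map_in_inj (T U : eqType) (f : T -> U) s :
  uniq (map f s) -> {in s &, injective f}.
Proof.
elim: s => //= a s IHs /andP[nfa /IHs inj_f] c d; rewrite !inE.
case/predU1P=> [->|cs] /predU1P[->|ds] // e; last exact: inj_f.
  by case/negP: nfa; rewrite e map_f.
by case/negP: nfa; rewrite -e map_f.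
Qed.

Lemma plane_word_inj : {in codes &, injective (plane \o word)}.
Proof.
apply: uniq_map_in_inj; rewrite uniq_pairwise pairwise_map.
have := lines_pairwise; rewrite pairwise_map; apply: sub_pairwise => c d.
by rewrite /= eq_plane !word_nat.
Qed.

(** Once the words are known to be shortest, the bound on lengths says that a
    simple transposition raises the height by at most one. The planes are
    tabulated so that those to be compared with are evaluated only once. *)
Lemma lines_closed :
  let table := [seq (size (nat_word c), lines (act (nat_word c))) | c <- codes] in
  all (fun c => all (fun i =>
         let l := lines (act (rcons (nat_word c) i)) in
         has (fun p => all [in p.2] l && (p.1 <= (size (nat_word c)).+1)) table)
       (iota 0 7)) codes.
Proof. by vm_cast_no_check (erefl true). Qed.

(** As every plane is reached by some word, each is the plane of a code. Since
    distinct codes give distinct planes, the bound also shows that no word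
    reaching the plane of c is shorter than [word c]. *)
Lemma plane_reach s :
  exists2 c, c \in codes & plane s = plane (word c) /\ size (word c) <= size s.
Proof.
elim/last_ind: s => [|s i [c cC [sc le_cs]]].
  exists (0, 0, 0, 0); first by rewrite mem_codes.
  by rewrite /= !take0.
have /allP/(_ c cC)/allP/(_ (val i)) := lines_closed.
rewrite mem_iota ltn_ord => /(_ isT)/hasP[_ /mapP[d dC ->] /= /andP[same le_dc]].
exists d => //; split; last first.
  by rewrite size_rcons size_word (leq_trans le_dc) // ltnS -size_word.
rewrite plane_rcons sc -plane_rcons; apply/eqP.
by rewrite eq_plane map_rcons !word_nat.
Qed.

(** * Insertions and the Bruhat order *)

Definition reduced s := ht (plane s) == size s.

(** A shortest word for the plane of c leads to a code d with [word d] no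
    longer; as distinct codes give distinct planes, d is c. *)
Lemma word_reduced c : c \in codes -> reduced (word c).
Proof.
move=> cC; rewrite /reduced eqn_leq ht_plane_le /=.
have [s [sc <-]] := ht_word (plane (word c)).
have [d dC [sd le_ds]] := plane_reach s.
by rewrite (plane_word_inj cC dC) //= -sc.
Qed.

Lemma bruhat_insert u i v : reduced (u ++ v) -> reduced (u ++ i :: v) ->
  bruhat (plane (u ++ v)) (plane (u ++ i :: v)).
Proof.
move=> /eqP red_uv /eqP red_uiv; apply: connect1.
have [p [q [npq e]]] := plane_insert u i v.
apply/existsP; exists p; apply/existsP; exists q.
by rewrite npq -e eqxx red_uv red_uiv !size_cat addnS ltnSn.
Qed.

(** Lengthening a prefix of p inserts its letters one at a time, inside a word
    that stays reduced throughout. *)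
Lemma bruhat_take u p v m n : m <= n -> n <= size p ->
  (forall k, k <= n -> reduced (u ++ take k p ++ v)) ->
  bruhat (plane (u ++ take m p ++ v)) (plane (u ++ take n p ++ v)).
Proof.
elim: n => [|n IHn]; first by rewrite leqn0 => /eqP-> *; apply: connect0.
rewrite leq_eqVlt => /predU1P[-> *|le_mn lt_np red]; first exact: connect0.
apply: connect_trans (IHn le_mn (ltnW lt_np) _) _ => [k le_kn|].
  by apply: red; apply: leqW.
have := red n.+1 (leqnn _); have := red n (leqnSn n).
case: p lt_np {IHn red} => // x0 p lt_np.
by rewrite (take_nth x0) // cat_rcons !catA; apply: bruhat_insert.
Qed.

Lemma bruhat_word i j k l i' j' k' l' :
  i <= i' -> j <= j' -> k <= k' -> l <= l' -> (i', j', k', l') \in codes ->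
  bruhat (plane (word (i, j, k, l))) (plane (word (i', j', k', l'))).
Proof.
move=> le_i le_j le_k le_l; rewrite mem_codes => /and4P[ri rj rk rl].
have red a b c d : a <= i' -> b <= j' -> c <= k' -> d <= l' ->
    reduced (word (a, b, c, d)).
  move=> la lb lc ld; apply: word_reduced; rewrite mem_codes.
  by rewrite (leq_ltn_trans la) // (leq_ltn_trans lb) // (leq_ltn_trans lc) //
             (leq_ltn_trans ld).
have size_down n : n <= 7 -> size (down n) = n.
  by move=> n7; rewrite size_rev size_take size_enum_ord; case: ltngtP n7.
pose d n := down n.
(* The chain raises l, k, j and i in turn; each link changes a single block of
   the word, and every word on the way has a code below (i', j', k', l'). *)
have e7 : bruhat (plane (word (i, j', k', l'))) (plane (word (i', j', k', l'))).
  have := @bruhat_take (take l' (d 1) ++ take k' (d 2) ++ take j' (d 4)) (d 7) [::].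
  move=> /(_ i i' le_i); rewrite !cats0 -!catA size_down //; apply=> // a la.
  by rewrite cats0 -!catA; apply: (red a j' k' l').
have e4 : bruhat (plane (word (i, j, k', l'))) (plane (word (i, j', k', l'))).
  have := @bruhat_take (take l' (d 1) ++ take k' (d 2)) (d 4) (take i (d 7)).
  move=> /(_ j j' le_j); rewrite -!catA size_down //; apply=> // a la.
  by rewrite -!catA; apply: (red i a k' l').
have e2 : bruhat (plane (word (i, j, k, l'))) (plane (word (i, j, k', l'))).
  have := @bruhat_take (take l' (d 1)) (d 2) (take j (d 4) ++ take i (d 7)).
  move=> /(_ k k' le_k); rewrite size_down //; apply=> // a la.
  exact: (red i j a l').
have e1 : bruhat (plane (word (i, j, k, l))) (plane (word (i, j, k, l'))).
  have := @bruhat_take [::] (d 1) (take k (d 2) ++ take j (d 4) ++ take i (d 7)).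
  move=> /(_ l l' le_l); rewrite size_down //; apply=> // a la.
  exact: (red i j k a).
exact: connect_trans e1 (connect_trans e2 (connect_trans e4 e7)).
Qed.

(** * The Lehmer code *)

(** Reading from the last position to the first: once w is known beyond m, the
    set V of its values at positions at most m is known, and kappa tells how many
    elements of V exceed w m, hence which element of V it is. *)
Lemma kappa_inj w w' :
  (forall j, 0 < j <= 8 -> kappa j w = kappa j w') -> w = w'.
Proof.
move=> eq_k; apply/permP.
suff eqw n : forall m : 'I_8, 8 - m <= n -> w m = w' m.
  by move=> m; apply: eqw (leqnn _).
elim: n => [|n IHn] m le_mn; first by move: le_mn; rewrite leqn0 subn_eq0 leqNgt ltn_ord.
have eq_gt (k : 'I_8) : m < k -> w k = w' k.
  move=> lt_mk; apply: IHn; rewrite -ltnS; apply: leq_trans le_mn.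
  by rewrite ltn_sub2l.
pose V (u : 'S_8) := [set u k | k in [pred k : 'I_8 | k <= m]].
have inV (u : 'S_8) (k : 'I_8) : (u k \in V u) = (k <= m).
  by rewrite mem_imset ?inE //; apply: perm_inj.
have eqV : V w = V w'.
  have VE (u : 'S_8) : V u = ~: [set u k | k in [pred k : 'I_8 | m < k]].
    apply/setP=> x; rewrite -(permKV u x) inE inV leqNgt mem_imset ?inE //.
    exact: perm_inj.
  by rewrite !VE; congr (~: _); apply: eq_in_imset => k; rewrite inE; apply: eq_gt.
(* Position m is number m + 1 when counted from 1. *)
have kV (u : 'S_8) : kappa m.+1 u = #|[set x in V u | u m < x]|.
  have lab_m : lab m.+1 = m by apply: val_inj; rewrite /= modn_small.
  rewrite /kappa lab_m -[LHS](card_imset _ (@perm_inj _ u)); apply: eq_card => x.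
  rewrite -(permKV u x); move: (_ x) => k.
  rewrite mem_imset; last exact: perm_inj.
  rewrite !inE inV [X in _ = X && _]leq_eqVlt.
  by case: eqP => [/val_inj->|]; rewrite ?ltnn ?andbF.
have ltk u u' : V u = V u' -> u m < u' m -> kappa m.+1 u' < kappa m.+1 u.
  move=> eV lt_u; rewrite !kV; apply/proper_card/properP; split.
    by apply/subsetP=> x; rewrite !inE eV => /andP[->]; apply: ltn_trans.
  by exists (u' m); rewrite !inE ?ltnn ?andbF // eV inV leqnn.
have /eq_k ek : 0 < m.+1 <= 8 by rewrite /= ltn_ord.
case: (ltngtP (w m) (w' m)) => [/(ltk _ _ eqV)|/(ltk _ _ (esym eqV))|/val_inj//];
  by rewrite ek ltnn.
Qed.

Definition nat_kappa (j : nat) (s : seq nat) : nat :=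
  count (fun i => (i < lab j) && (act s (lab j) < act s i)) (iota 0 8).

Lemma kappa_word_perm j s : kappa j (word_perm s) = nat_kappa j (map val s).
Proof.
rewrite /kappa /nat_kappa -val_enum_ord count_map cardsE cardE size_filter enumT.
by apply: eq_count => i; rewrite [LHS]unfold_in !word_permE.
Qed.

Lemma nat_kappa_codes :
  all (fun c => let s := nat_word c in
    [&& nat_kappa 7 s == 0, nat_kappa 6 s == 0, nat_kappa 4 s == 0
      & (nat_kappa 8 s, nat_kappa 5 s, nat_kappa 3 s, nat_kappa 2 s) == c]) codes.
Proof. by vm_cast_no_check (erefl true). Qed.

Definition code_of (a : grid) : code :=
  (val a.1.1.1, val a.1.1.2, val a.1.2, val a.2).

Lemma code_of_in a : code_of a \in codes.
Proof. by rewrite mem_codes !ltn_ord. Qed.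

Lemma code_of_inj : injective code_of.
Proof.
by move=> [[[i j] k] l] [[[i' j'] k'] l'] [] /val_inj-> /val_inj-> /val_inj-> /val_inj->.
Qed.

Definition rep (a : grid) : 'S_8 := word_perm (word (code_of a)).

Lemma rep_in_C a : rep a \in C.
Proof.
have /allP/(_ _ (code_of_in a)) := nat_kappa_codes.
by rewrite inE !kappa_word_perm word_nat => /and4P[-> -> ->].
Qed.

Lemma kappa'_rep a : kappa' (rep a) = a.
Proof.
have /allP/(_ _ (code_of_in a))/and4P[_ _ _ /eqP e] := nat_kappa_codes.
by apply: code_of_inj; rewrite -e /code_of /= !kappa_word_perm word_nat.
Qed.

(** Both permutations have the same seven nontrivial kappa statistics: four by
    [kappa'_rep], and three that vanish on C. *)
Lemma rep_kappa' c : c \in C -> rep (kappa' c) = c.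
Proof.
move=> cC; have := rep_in_C (kappa' c); have := kappa'_rep (kappa' c).
move: cC; rewrite !inE; move: (rep _) => d.
case/and3P=> /eqP c7 /eqP c6 /eqP c4 /(congr1 code_of)[d8 d5 d3 d2].
case/and3P=> /eqP d7 /eqP d6 /eqP d4; apply: kappa_inj.
case=> [|[|[|[|[|[|[|[|[|j]]]]]]]]] // _; rewrite ?c7 ?c6 ?c4 //.
Qed.

(** * The labelling and its inverse *)

Definition packing (a : grid) : Omega240 := relabel (rep a) x0.

Lemma packing_surj x : exists a, packing a == x.
Proof.
have [s [<- _]] := ht_word x; have [c cC [-> _]] := plane_reach s.
case: c cC => [[[i j] k] l]; rewrite mem_codes => /and4P[ri rj rk rl].
by exists (Ordinal ri, Ordinal rj, Ordinal rk, Ordinal rl).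
Qed.

Lemma packing_inj : injective packing.
Proof.
move=> a b e; apply: code_of_inj.
exact: plane_word_inj (code_of_in a) (code_of_in b) e.
Qed.

Lemma packing_monotone : {homo packing : a b / (a <= b)%O}.
Proof.
move=> a b /andP[/andP[/andP[le_i le_j] le_k] le_l].
exact: bruhat_word (code_of_in b).
Qed.

HB.instance Definition _ :=
  Order.isOrderMorphism.Build _ grid _ Omega240 packing packing_monotone.

Theorem theorem3p8 :
  exists L : Omega240 -> grid,
    [/\ forall c, c \in C -> L (relabel c x0) = kappa' c,
        forall L' : Omega240 -> grid,
          (forall c, c \in C -> L' (relabel c x0) = kappa' c) -> L' =1 L
      & exists M : {omorphism grid -> Omega240}, cancel L M /\ cancel M L].
Proof.
pose L x := xchoose (packing_surj x).
have LK : cancel L packing by move=> x; apply/eqP/(xchooseP (packing_surj x)).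
have packingK : cancel packing L by move=> a; apply: packing_inj; rewrite LK.
exists L; split; last by exists packing.
  by move=> c cC; rewrite -[in LHS](rep_kappa' cC) packingK.
move=> L' L'E x; rewrite -{1}[x]LK -[RHS]kappa'_rep.
exact/L'E/rep_in_C.
Qed.
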